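(* There is a data structure that maintains, for a dynamic finite point set $S\subset\mathbb{R}$ (undergoing point insertions and deletions), a laminar near-perfect matching of depth $O(\log|S|)$ such that it modifies (adds or deletes) at most $O(\log^2|S|)$ edges in each step.
   Context: A near-perfect matching covers all but at most one point of $S$. A set $E$ of edges on $S$ (each edge $ab$ viewed as the interval between $a$ and $b$) is laminar if there are no two edges $a_1b_1,a_2b_2$ with $a_1<a_2<b_1<b_2$. For a laminar set $E$, its depth is the maximum number of pairwise overlapping edges of $E$, equivalently the maximum length of a chain $e_1\prec e_2\prec\dots$ of edges where $e\prec e'$ means the interval $e'$ properly contains $e$. *)

(* Defs.v *)
From HB Require Import structures.
From mathcomp Require Import all_boot all_order all_algebra finmap.
From mathcomp Require Import reals exp.

Set Implicit Arguments.
Unset Strict Implicit.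
Unset Printing Implicit Defensive.

Import Order.TTheory GRing.Theory Num.Theory.

Local Open Scope fset_scope.
Local Open Scope ring_scope.

Section LaminarMatching.
Variable R : realType.

(* The edge ab with a < b is the pair (a, b); [is_edge_set] imposes a < b. *)
Definition edge : Type := (R * R)%type.

Definition incident (x : R) (e : edge) : bool := (x == e.1) || (x == e.2).

Definition is_edge_set (S : {fset R}) (E : {fset edge}) : Prop :=
  forall e, e \in E -> [/\ e.1 < e.2, e.1 \in S & e.2 \in S].

Definition is_matching (S : {fset R}) (E : {fset edge}) : Prop :=
  is_edge_set S E /\
  (forall e f x, e \in E -> f \in E -> incident x e -> incident x f -> e = f).

Definition near_perfect_matching (S : {fset R}) (E : {fset edge}) : Prop :=
  is_matching S E /\
  (#|` [fset x in S | ~~ has (incident x) E]| <= 1)%N.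

Definition laminar (E : {fset edge}) : Prop :=
  forall e f, e \in E -> f \in E ->
    ~ [/\ e.1 < f.1, f.1 < e.2 & e.2 < f.2].

(* For edges with a < b: the open intervals ]e.1, e.2[ and ]f.1, f.2[ meet.
   Edges of a matching share no endpoint, so closed intervals would give the
   same relation there; with open intervals, pairwise overlapping edges of any
   laminar edge set are exactly the chains for proper containment. *)
Definition overlap (e f : edge) : bool := (e.1 < f.2) && (f.1 < e.2).

Definition depth (E : {fset edge}) : nat :=
  \max_(C <- fpowerset E | all2rel overlap C) #|` C|.

Definition modified_edges (E E' : {fset edge}) : {fset edge} :=
  (E `\` E') `|` (E' `\` E).

Inductive update : Type := Insert of R | Delete of R.

(* Inserting a present point, or deleting an absent one, changes nothing. *)
Definition apply_update (S : {fset R}) (u : update) : {fset R} :=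
  match u with
  | Insert x => x |` S
  | Delete x => S `\ x
  end.

(* Updates are listed in chronological order, starting from the empty set. *)
Definition point_set (us : seq update) : {fset R} :=
  foldl apply_update fset0 us.

(* A deterministic online data structure: the maintained edge set is a function
   of a state that is updated without knowledge of the future.  States are
   arbitrary, since only edge modifications are counted, not running time. *)
Record data_structure : Type := DataStructure {
  ds_state : Type;
  ds_init : ds_state;
  ds_step : ds_state -> update -> ds_state;
  ds_edges : ds_state -> {fset edge}
}.

Definition maintained (D : data_structure) (us : seq update) : {fset edge} :=
  ds_edges (foldl (@ds_step D) (ds_init D) us).

End LaminarMatching.

(* Main.v *)
Require Import Defs.
From HB Require Import structures.
From mathcomp Require Import all_boot all_order all_algebra finmap.
From mathcomp Require Import reals exp.
From mathcomp Require Import zify lra ring.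

Set Implicit Arguments.
Unset Strict Implicit.
Unset Printing Implicit Defensive.

Import Order.TTheory GRing.Theory Num.Theory.

Local Open Scope fset_scope.
Local Open Scope ring_scope.


(** Store the points in the leaves of an AVL tree.  Each subtree with an odd
    number of leaves leaves one point unmatched, and at every node whose two
    children both have an unmatched point, these two points are joined by an edge.
    By induction the unmatched point of a subtree lies under no edge, so the new
    edge crosses nothing; and each level of the tree adds at most one edge to a
    nested chain, so the depth is at most the height, which is O(log |S|).  The
    edges within a subtree depend on that subtree only, so that an update, which
    rebuilds a root-to-leaf path with a bounded number of rotations per level,
    modifies O(log |S|) edges. *)

Section LaminarTree.
Variable R : realType.
Implicit Types (x y p q : R) (e f : edge R) (E F G P Q X : {fset edge R}).

(** * Sizes of symmetric differences of edge sets *)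

Lemma modified_edges_le E F P Q X :
  E `<=` P `|` X -> X `<=` E -> F `<=` Q `|` X -> X `<=` F ->
  (#|` modified_edges E F| <= #|` P| + #|` Q|)%N.
Proof.
move=> /fsubsetP EP /fsubsetP XE /fsubsetP FQ /fsubsetP XF.
rewrite -cardfsUI; apply: leq_trans (leq_addr _ _).
(* Since [X] is common to both sets, an edge of [E] outside [F] avoids [X] and hence lies in [P];
   likewise an edge of [F] outside [E] lies in [Q]. *)
apply: fsubset_leq_card; apply/fsubsetP => e; rewrite !inE => /orP[] /andP[nF /[dup] eE].
  by move=> /EP; rewrite inE => /orP[-> //|/XF]; rewrite (negPf nF).
by move=> /FQ; rewrite inE => /orP[->|/XE]; rewrite ?orbT// (negPf nF).
Qed.

Lemma modified_edgesC E F : modified_edges E F = modified_edges F E.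
Proof. by rewrite /modified_edges fsetUC. Qed.

Lemma modified_edges_trans F E G :
  (#|` modified_edges E G| <=
    #|` modified_edges E F| + #|` modified_edges F G|)%N.
Proof.
rewrite -cardfsUI; apply: leq_trans (leq_addr _ _).
apply: fsubset_leq_card; apply/fsubsetP => e; rewrite !inE.
by case: (e \in E); case: (e \in F); case: (e \in G).
Qed.

Lemma modified_edgesU E E' F F' :
  (#|` modified_edges (E `|` F) (E' `|` F')| <=
    #|` modified_edges E E'| + #|` modified_edges F F'|)%N.
Proof.
rewrite -cardfsUI; apply: leq_trans (leq_addr _ _).
apply: fsubset_leq_card; apply/fsubsetP => e; rewrite !inE.
by case: (e \in E); case: (e \in F); case: (e \in E'); case: (e \in F').
Qed.

Lemma modified_edgesxx E : modified_edges E E = fset0.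
Proof. by rewrite /modified_edges fsetDv fsetU0. Qed.

Lemma modified_edgesx0 E : modified_edges E fset0 = E.
Proof. by rewrite /modified_edges fsetD0 fset0D fsetU0. Qed.

(** * Leaf-oriented AVL trees and the matching read off from them *)

Inductive tree : Type := Leaf of R | Node of tree & tree.
Implicit Types (t l r : tree) (ol or : option tree).

Fixpoint points t : seq R :=
  match t with Leaf x => [:: x] | Node l r => points l ++ points r end.

Fixpoint height t : nat :=
  match t with Leaf _ => 0 | Node l r => (maxn (height l) (height r)).+1 end.

(** Inner nodes store no key: in an ordered tree the first leaf of the right subtree serves as the
    search key. *)
Fixpoint leftmost t : R :=
  match t with Leaf x => x | Node l _ => leftmost l end.

(** The value is [Some] exactly when the number of leaves is odd. *)
Fixpoint unmatched t : option R :=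
  match t with
  | Leaf x => Some x
  | Node l r => match unmatched l, unmatched r with
                | Some _, Some _ => None
                | Some p, None => Some p
                | None, o => o
                end
  end.

Definition root_edge l r : {fset edge R} :=
  match unmatched l, unmatched r with
  | Some p, Some q => [fset (p, q)]
  | _, _ => fset0
  end.

Fixpoint matching t : {fset edge R} :=
  match t with
  | Leaf _ => fset0
  | Node l r => root_edge l r `|` (matching l `|` matching r)
  end.

Definition ordered t := pairwise <%R (points t).

Fixpoint avl t : bool :=
  match t with
  | Leaf _ => true
  | Node l r => [&& avl l, avl r, height l <= (height r).+1
                  & height r <= (height l).+1]%N
  end.

(** On the side that is too high, a single rotation if the outer grandchild is at least as high as
    the inner one, and a double rotation otherwise. *)
Definition balance l r : tree :=
  if ((height r).+1 < height l)%N then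
    match l with
    | Node a b =>
        if (height b <= height a)%N then Node a (Node b r)
        else if b is Node b1 b2 then Node (Node a b1) (Node b2 r) else Node l r
    | Leaf _ => Node l r
    end
  else if ((height l).+1 < height r)%N then
    match r with
    | Node a b =>
        if (height a <= height b)%N then Node (Node l a) b
        else if a is Node a1 a2 then Node (Node l a1) (Node a2 b) else Node l r
    | Leaf _ => Node l r
    end
  else Node l r.

Fixpoint insert x t : tree :=
  match t with
  | Leaf y => if x < y then Node (Leaf x) t
              else if y < x then Node t (Leaf x) else t
  | Node l r => if x < leftmost r then balance (insert x l) r
                else balance l (insert x r)
  end.

Definition obalance ol or : option tree :=
  match ol, or with
  | Some l, Some r => Some (balance l r)
  | None, _ => or
  | _, None => ol
  end.

Fixpoint delete x t : option tree :=
  match t with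
  | Leaf y => if x == y then None else Some t
  | Node l r => if x < leftmost r then obalance (delete x l) (Some r)
                else obalance (Some l) (delete x r)
  end.

(** * Leaf order and height balance under updates *)

Lemma ordered_node l r : ordered (Node l r) =
  [&& allrel <%R (points l) (points r), ordered l & ordered r].
Proof. exact: pairwise_cat. Qed.

Lemma ordered_lt l r x y :
  ordered (Node l r) -> x \in points l -> y \in points r -> x < y.
Proof. by rewrite ordered_node => /and3P[/allrelP lr _ _]; apply: lr. Qed.

Lemma leftmost_points t : leftmost t \in points t.
Proof. by elim: t => [x|l IHl r _] /=; rewrite ?inE// mem_cat IHl. Qed.

Lemma leftmost_le t x : ordered t -> x \in points t -> leftmost t <= x.
Proof.
elim: t => [y|l IHl r _] /=; first by rewrite inE => _ /eqP->.
move=> /[dup] lr; rewrite ordered_node => /and3P[_ ol _].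
rewrite mem_cat => /orP[/(IHl ol)//|xr].
by apply/ltW/(ordered_lt lr) => //; exact: leftmost_points.
Qed.

Lemma points_balance l r : points (balance l r) = points l ++ points r.
Proof.
rewrite /balance; case: ifP => _.
  case: l => [//|a b]; case: ifP => _ /=; first by rewrite catA.
  by case: b => [//|b1 b2] /=; rewrite !catA.
case: ifP => _ //; case: r => [//|a b]; case: ifP => _ /=; first by rewrite catA.
by case: a => [//|a1 a2] /=; rewrite !catA.
Qed.

(** A height difference of two is the worst that one update in a child of an AVL node can cause.
    After a rotation the two bounds on the height suffice; without one the exact value is recorded,
    because the lower bound alone would be one too small to show that an update changes the height
    by at most one. *)
Lemma avl_balance l r : avl l -> avl r ->
  (height l <= (height r).+2)%N -> (height r <= (height l).+2)%N ->
  [/\ avl (balance l r),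
      (maxn (height l) (height r) <= height (balance l r))%N,
      (height (balance l r) <= (maxn (height l) (height r)).+1)%N
    & (height l <= (height r).+1)%N -> (height r <= (height l).+1)%N ->
      height (balance l r) = (maxn (height l) (height r)).+1].
Proof.
rewrite /balance; case: (ltnP (height r).+1 (height l)) => [hlr|hlr].
  case: l hlr => [x|a b] //= hlr; case: (leqP (height b) (height a)) => hab /=.
    by move=> /and4P[-> -> ? ?] -> ? ?; split => /=; lia.
  case: b hlr hab => [x|b1 b2] //= hlr hab.
  by move=> /and4P[-> /and4P[-> -> ? ?] ? ?] -> ? ?; split => /=; lia.
case: (ltnP (height l).+1 (height r)) => [hrl|hrl]; last first.
  by move=> /= -> -> ? ?; split => /=; lia.
case: r hlr hrl => [x|a b] //= hlr hrl al.
case: (leqP (height a) (height b)) => hab /=.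
  by move=> /and4P[-> -> ? ?] ? ?; rewrite al; split => /=; lia.
case: a hlr hrl hab => [x|a1 a2] //= hlr hrl hab.
by move=> /and4P[/and4P[-> -> ? ?] -> ? ?] ? ?; rewrite al; split => /=; lia.
Qed.

Lemma avl_insert x t : avl t ->
  [/\ avl (insert x t), (height t <= height (insert x t))%N
    & (height (insert x t) <= (height t).+1)%N].
Proof.
elim: t => [y|l IHl r IHr] /=; first by case: ifP => // _; case: ifP.
move=> /and4P[al ar hlr hrl]; case: ifP => _.
  have [{}al' h1 h2] := IHl al.
  by have [|| -> ? ? ?] := avl_balance al' ar; [lia|lia|split=> //; lia].
have [{}ar' h1 h2] := IHr ar.
by have [|| -> ? ? ?] := avl_balance al ar'; [lia|lia|split=> //; lia].
Qed.

Lemma avl_delete x t : avl t ->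
  if delete x t is Some t' then
    [/\ avl t', (height t' <= height t)%N & (height t <= (height t').+1)%N]
  else height t = 0%N.
Proof.
elim: t => [y|l IHl r IHr] /=; first by case: ifP.
move=> /and4P[al ar hlr hrl]; case: ifP => _.
  (* If the child vanishes, it was a single leaf, and its sibling is exactly one lower than the
     whole tree. *)
  case: (delete x l) (IHl al) => [l' [al' h1 h2]|h0] /=; last by split=> //; lia.
  by have [|| -> ? ? ?] := avl_balance al' ar; [lia|lia|split=> //; lia].
case: (delete x r) (IHr ar) => [r' [ar' h1 h2]|h0] /=; last by split=> //; lia.
by have [|| -> ? ? ?] := avl_balance al ar'; [lia|lia|split=> //; lia].
Qed.

(** This says that the height is at most twice the binary logarithm of the number of leaves. If [h]
    is the smaller height of the two children and [a], [b] are their numbers of leaves, then [a ^ 2]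
    and [b ^ 2] are at least [2 ^ h], so [(a + b) ^ 2] is at least [4 * 2 ^ h], while the height of
    the node is at most [h + 2]. *)
Lemma avl_size t : avl t -> (2 ^ height t <= size (points t) ^ 2)%N.
Proof.
elim: t => [//|l IHl r IHr] /= /and4P[/IHl hl /IHr hr hlr hrl].
rewrite size_cat; set a := size _ in hl *; set b := size _ in hr *.
have [h hh] : exists h, [/\ (height l = h \/ height l = h.+1),
    (height r = h \/ height r = h.+1) &
    (2 ^ (maxn (height l) (height r)).+1 <= 4 * 2 ^ h)%N].
  exists (minn (height l) (height r)); split; [lia|lia|].
  by rewrite -[4%N]/(2 ^ 2)%N -expnD leq_exp2l//; lia.
have lb k : (k = h \/ k = h.+1) -> (2 ^ h <= 2 ^ k)%N.
  by move=> hk; rewrite leq_exp2l//; lia.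
case: hh => /lb hl' /lb hr' /leq_trans; apply.
have ha := leq_trans hl' hl; have hb := leq_trans hr' hr.
by rewrite !expnS !expn0 in ha hb *; nia.
Qed.

Lemma mem_insert x t y : (y \in points (insert x t)) = (y == x) || (y \in points t).
Proof.
elim: t => [z|l IHl r IHr] /=; last first.
  by case: ifP => _; rewrite points_balance !mem_cat ?IHl ?IHr ?orbA// -!orbA orbCA.
case: (ltgtP x z) => [_|_|->]; rewrite /= !inE// ?orbb//.
by rewrite orbC.
Qed.

Lemma ordered_insert x t : ordered t -> ordered (insert x t).
Proof.
elim: t => [y|l IHl r IHr] /=.
  by rewrite /ordered; case: (ltgtP x y) => //= ->.
move=> /[dup] lr; rewrite ordered_node => /and3P[/allrelP slr sl sr].
case: ltP => hx; rewrite /ordered points_balance pairwise_cat.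
  rewrite [pairwise _ _]IHl// [pairwise _ _]sr !andbT; apply/allrelP => u v.
  rewrite mem_insert => /orP[/eqP->|]; last exact: slr.
  by move=> /(leftmost_le sr); apply: lt_le_trans.
rewrite [pairwise _ _]sl [pairwise _ _]IHr// !andbT; apply/allrelP => u v ul.
rewrite mem_insert => /orP[/eqP->|]; last exact: slr.
by apply: lt_le_trans hx; apply: slr => //; exact: leftmost_points.
Qed.

Definition opoints ol : seq R := oapp points [::] ol.

Definition omatching ol : {fset edge R} := oapp matching fset0 ol.

Lemma opoints_balance ol or : opoints (obalance ol or) = opoints ol ++ opoints or.
Proof. by case: ol or => [l|] [r|] //=; rewrite ?points_balance ?cats0. Qed.

Lemma points_delete x t : ordered t ->
  opoints (delete x t) = [seq y <- points t | y != x].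
Proof.
elim: t => [y|l IHl r IHr]; first by rewrite /= eq_sym; case: ifP.
move=> /[dup] lr; rewrite ordered_node => /and3P[_ sl sr].
rewrite [delete _ _]/= -/(obalance (Some l) (delete x r)).
case: ltP => hx; rewrite opoints_balance filter_cat ?IHl ?IHr//; congr cat.
  apply/esym/all_filterP/allP => y /(leftmost_le sr) hy.
  by rewrite gt_eqF// (lt_le_trans hx hy).
apply/esym/all_filterP/allP => y yl.
by rewrite lt_eqF// (lt_le_trans _ hx)// (ordered_lt lr yl)// leftmost_points.
Qed.

(** * Number of edges modified by one update *)

Lemma card_root_edge l r : (#|` root_edge l r| <= 1)%N.
Proof.
rewrite /root_edge; case: unmatched => [p|]; last by rewrite cardfs0.
by case: unmatched => [q|]; rewrite ?cardfs0 ?cardfs1.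
Qed.

(** The constant 2 pays for the old and the new root edge; all other edges belong to the
    children. *)
Lemma modified_node l r l' r' :
  (#|` modified_edges (matching (Node l r)) (matching (Node l' r'))| <=
    2 + (#|` modified_edges (matching l) (matching l')| +
         #|` modified_edges (matching r) (matching r')|))%N.
Proof.
apply: leq_trans (modified_edgesU _ _ _ _) _.
apply: leq_add; last exact: modified_edgesU.
apply: leq_trans (@modified_edges_le _ _ (root_edge l r) (root_edge l' r')
  fset0 _ _ _ _) _; rewrite ?fsetU0 ?fsub0set//.
exact: leq_add (card_root_edge _ _) (card_root_edge _ _).
Qed.

(** The subtrees [a], [b], [c] keep their edges, collected in [X]. Outside [X], each of the two
    trees has only the root edges of its two upper nodes. *)
Lemma modified_rotate a b c :
  (#|` modified_edges (matching (Node (Node a b) c))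
                      (matching (Node a (Node b c)))| <= 4)%N.
Proof.
pose X := matching a `|` matching b `|` matching c.
apply: leq_trans (@modified_edges_le _ _
  (root_edge (Node a b) c `|` root_edge a b)
  (root_edge a (Node b c) `|` root_edge b c) X _ _ _ _) _.
- by apply/fsubsetP => e; rewrite !inE; do ![case: (_ \in _)].
- by apply/fsubsetP => e; rewrite !inE; do ![case: (_ \in _)].
- by apply/fsubsetP => e; rewrite !inE; do ![case: (_ \in _)].
- by apply/fsubsetP => e; rewrite !inE; do ![case: (_ \in _)].
have cU P Q : (#|` P| <= 1 -> #|` Q| <= 1 -> #|` P `|` Q| <= 2)%N.
  by move=> hP hQ; rewrite -[2%N]/(1 + 1)%N cardfsU; lia.
by rewrite -[4%N]/(2 + 2)%N; apply: leq_add; apply: cU; exact: card_root_edge.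
Qed.

Lemma modified_balance l r :
  (#|` modified_edges (matching (Node l r)) (matching (balance l r))| <= 10)%N.
Proof.
rewrite /balance; have dxx E : (#|` modified_edges E E| <= 10)%N.
  by rewrite modified_edgesxx cardfs0.
have rotl a b c := modified_rotate a b c.
have rotr a b c : (#|` modified_edges (matching (Node a (Node b c)))
    (matching (Node (Node a b) c))| <= 4)%N by rewrite modified_edgesC.
have sub a b a' b' := @modified_node a b a' b'.
case: ifP => _.
  case: l => [x|a b]; first exact: dxx.
  case: ifP => _; first exact: leq_trans (rotl _ _ _) _.
  case: b => [x|b1 b2]; first exact: dxx.
  (* A double rotation is a rotation inside the child, costing 4 and 2 more for the root edges above
     it, followed by a rotation at the root, costing 4. *)
  set F := matching (Node (Node (Node a b1) b2) r).
  apply: leq_trans (modified_edges_trans F _ _) _.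
  rewrite -[10%N]/(6 + 4)%N; apply: leq_add; last exact: rotl.
  apply: leq_trans (sub _ _ _ _) _; rewrite modified_edgesxx cardfs0 addn0.
  exact: (@leq_add 2 _ 2 4 _ (rotr _ _ _)).
case: ifP => _; last exact: dxx.
case: r => [x|a b]; first exact: dxx.
case: ifP => _; first exact: leq_trans (rotr _ _ _) _.
case: a => [x|a1 a2]; first exact: dxx.
set F := matching (Node l (Node a1 (Node a2 b))).
apply: leq_trans (modified_edges_trans F _ _) _.
rewrite -[10%N]/(6 + 4)%N; apply: leq_add; last exact: rotr.
apply: leq_trans (sub _ _ _ _) _; rewrite modified_edgesxx cardfs0 add0n.
exact: (@leq_add 2 _ 2 4 _ (rotl _ _ _)).
Qed.

Lemma modified_node_balance l r l' r' :
  (#|` modified_edges (matching (Node l r)) (matching (balance l' r'))| <=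
    12 + (#|` modified_edges (matching l) (matching l')| +
          #|` modified_edges (matching r) (matching r')|))%N.
Proof.
apply: leq_trans (modified_edges_trans (matching (Node l' r')) _ _) _.
rewrite -[12%N]/(10 + 2)%N -addnA addnC; apply: leq_add.
  exact: modified_balance.
exact: modified_node.
Qed.

(** Each node of the search path costs at most 12: 10 for rebalancing and 2 for its root edge. The
    successor in the bound pays for the new edge at the leaf where the search ends. *)
Lemma modified_insert x t :
  (#|` modified_edges (matching t) (matching (insert x t))|
    <= 12 * (height t).+1)%N.
Proof.
elim: t => [y|l IHl r IHr]; rewrite [insert _ _]/=.
  case: ifP => _; last case: ifP => _; last by rewrite modified_edgesxx cardfs0.
    rewrite modified_edgesC /= !fsetU0 modified_edgesx0.
    exact: leq_trans (card_root_edge _ _) _.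
  rewrite modified_edgesC /= !fsetU0 modified_edgesx0.
  exact: leq_trans (card_root_edge _ _) _.
case: ifP => _; apply: leq_trans (modified_node_balance _ _ _ _) _;
  rewrite modified_edgesxx cardfs0 ?addn0 ?add0n.
  by apply: leq_trans (leq_add (leqnn _) IHl) _; rewrite /=; lia.
by apply: leq_trans (leq_add (leqnn _) IHr) _; rewrite /=; lia.
Qed.

Lemma modified_delete x t :
  (#|` modified_edges (matching t) (omatching (delete x t))|
    <= 12 * height t)%N.
Proof.
elim: t => [y|l IHl r IHr]; rewrite [delete _ _]/=.
  by case: ifP => _; rewrite /= modified_edgesxx cardfs0.
case: ifP => _.
  case: (delete x l) IHl => [l'|] IHl; rewrite [omatching _]/=.
    apply: leq_trans (modified_node_balance _ _ _ _) _.
    rewrite modified_edgesxx cardfs0 addn0.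
    by apply: leq_trans (leq_add (leqnn _) IHl) _; rewrite /=; lia.
  (* The remaining matching is padded with empty sets to the shape of a node's matching, so that the
     root edge, the edges of [l] and those of [r] can be compared separately; only the first two can
     disappear. *)
  rewrite -[matching r in X in modified_edges _ X]fset0U.
  rewrite -[fset0 `|` matching r]fset0U.
  apply: leq_trans (modified_edgesU _ _ _ _) _.
  apply: (@leq_trans (1 + 12 * height l)); last by rewrite /=; lia.
  apply: leq_add; first by rewrite modified_edgesx0 card_root_edge.
  apply: leq_trans (modified_edgesU _ _ _ _) _.
  by rewrite modified_edgesxx cardfs0 addn0.
case: (delete x r) IHr => [r'|] IHr; rewrite [omatching _]/=.
  apply: leq_trans (modified_node_balance _ _ _ _) _.
  rewrite modified_edgesxx cardfs0 add0n.
  by apply: leq_trans (leq_add (leqnn _) IHr) _; rewrite /=; lia.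
rewrite -[matching l in X in modified_edges _ X]fsetU0.
rewrite -[matching l `|` fset0]fset0U.
apply: leq_trans (modified_edgesU _ _ _ _) _.
apply: (@leq_trans (1 + 12 * height r)); last by rewrite /=; lia.
apply: leq_add; first by rewrite modified_edgesx0 card_root_edge.
apply: leq_trans (modified_edgesU _ _ _ _) _.
by rewrite modified_edgesxx cardfs0 add0n.
Qed.

(** * Near-perfectness, laminarity and depth of the matching *)

Lemma unmatched_points t p : unmatched t = Some p -> p \in points t.
Proof.
elim: t => [x|l IHl r IHr] /=; first by case=> ->; rewrite inE.
rewrite mem_cat; case: (unmatched l) IHl => [u|] IHl;
  case: (unmatched r) IHr => [v|] IHr //.
  by move=> /IHl->.
by move=> /IHr->; rewrite orbT.
Qed.

Lemma root_edgeP l r e : e \in root_edge l r ->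
  unmatched l = Some e.1 /\ unmatched r = Some e.2.
Proof.
rewrite /root_edge; case: unmatched => [p|//]; case: unmatched => [q|//].
by rewrite inE => /eqP->.
Qed.

Lemma root_edge_points l r e : e \in root_edge l r ->
  e.1 \in points l /\ e.2 \in points r.
Proof. by move=> /root_edgeP[] /unmatched_points ? /unmatched_points. Qed.

Lemma matching_edge t e : ordered t -> e \in matching t ->
  [/\ e.1 < e.2, e.1 \in points t & e.2 \in points t].
Proof.
elim: t => [x|l IHl r IHr] //= /[dup] lr; rewrite ordered_node => /and3P[_ sl sr].
rewrite !inE !mem_cat => /or3P[/root_edge_points[el er]|/(IHl sl)[-> -> ->]//|].
  by rewrite el er orbT (ordered_lt lr el er).
by move=> /(IHr sr)[-> -> ->]; rewrite !orbT.
Qed.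

(* The unmatched point is exposed: it is under no edge, so that joining it to a
   point outside the subtree crosses nothing. *)
Lemma unmatched_exposed t p e : ordered t -> unmatched t = Some p ->
  e \in matching t -> e.2 < p \/ p < e.1.
Proof.
elim: t p => [x|l IHl r IHr] p //= /[dup] lr.
rewrite ordered_node => /and3P[_ sl sr].
rewrite !inE /root_edge.
case ul: (unmatched l) => [u|]; case ur: (unmatched r) => [v|] //.
  move=> [<-] /or3P[//|/(IHl _ sl ul)//|/(matching_edge sr)[_ er _]].
  by right; apply: (ordered_lt lr) er; exact: unmatched_points.
move=> [<-] /or3P[//|/(matching_edge sl)[_ _ el]|/(IHr _ sr ur)//].
by left; apply: (ordered_lt lr) el _; exact: unmatched_points.
Qed.

(** The unmatched point of a child is either matched by the root edge or passed on as the unmatched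
    point of the node. *)
Lemma matching_cover t x : x \in points t ->
  has (incident x) (matching t) || (unmatched t == Some x).
Proof.
have sub E F : E `<=` F -> has (incident x) E -> has (incident x) F.
  by move=> /fsubsetP EF /hasP[e /EF eF xe]; apply/hasP; exists e.
elim: t => [y|l IHl r IHr] /=; first by rewrite inE => /eqP->; rewrite eqxx.
rewrite mem_cat => /orP[/IHl|/IHr] /orP[h|/eqP h].
- by rewrite (sub _ _ _ h)//; apply/fsubsetP => e; rewrite !inE => ->; rewrite orbT.
- rewrite h; case ur: (unmatched r) => [v|]; last by rewrite eqxx orbT.
  rewrite orbF; apply/hasP; exists (x, v); last by rewrite /incident eqxx.
  by rewrite /root_edge h ur !inE eqxx.
- by rewrite (sub _ _ _ h)//; apply/fsubsetP => e; rewrite !inE => ->; rewrite !orbT.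
- rewrite h; case ul: (unmatched l) => [v|]; last by rewrite eqxx orbT.
  rewrite orbF; apply/hasP; exists (v, x); last by rewrite /incident eqxx orbT.
  by rewrite /root_edge h ul !inE eqxx.
Qed.

Lemma incident_points t e x : ordered t -> e \in matching t -> incident x e ->
  x \in points t.
Proof. by move=> st /(matching_edge st)[_ h1 h2] /orP[] /eqP->. Qed.

(** An exposed point lies strictly outside the closed interval of every edge, so it cannot be an
    endpoint. *)
Lemma incident_unmatched t e x : ordered t -> e \in matching t ->
  incident x e -> unmatched t <> Some x.
Proof.
move=> st et xe ux; have [e12 _ _] := matching_edge st et.
have := unmatched_exposed st ux et.
by case/orP: xe => /eqP-> []; rewrite ?ltxx// ltNge (ltW e12).
Qed.

(** Edges of different children are separated by the order. The root edge ends in the unmatched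
    points of the children, which no edge inside the children touches. *)
Lemma matching_disjoint t e f x : ordered t -> e \in matching t ->
  f \in matching t -> incident x e -> incident x f -> e = f.
Proof.
elim: t e f => [y|l IHl r IHr] e f //= /[dup] lr.
rewrite ordered_node => /and3P[_ sl sr].
have root_l g h : g \in root_edge l r -> h \in matching l ->
    incident x g -> incident x h -> False.
  move=> /[dup] gr /root_edgeP[ul _] hl /orP[] /eqP xg xh.
    by apply: (incident_unmatched sl hl xh); rewrite xg.
  have [_ g2] := root_edge_points gr.
  by have := ordered_lt lr (incident_points sl hl xh) g2; rewrite xg ltxx.
have root_r g h : g \in root_edge l r -> h \in matching r ->
    incident x g -> incident x h -> False.
  move=> /[dup] gr /root_edgeP[_ ur] hr /orP[] /eqP xg xh; last first.
    by apply: (incident_unmatched sr hr xh); rewrite xg.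
  have [g1 _] := root_edge_points gr.
  by have := ordered_lt lr g1 (incident_points sr hr xh); rewrite xg ltxx.
have l_r g h : g \in matching l -> h \in matching r ->
    incident x g -> incident x h -> False.
  move=> gl hr xg xh.
  have := ordered_lt lr (incident_points sl gl xg) (incident_points sr hr xh).
  by rewrite ltxx.
rewrite !inE => /or3P[] he /or3P[] hf xe xf.
- have [[e1 e2] [f1 f2]] := (root_edgeP he, root_edgeP hf).
  move: f1 f2; rewrite e1 e2 => -[+] [].
  by case: e f {he hf xe xf e1 e2} => [? ?] [? ?] /= -> ->.
- by case: (root_l _ _ he hf xe xf).
- by case: (root_r _ _ he hf xe xf).
- by case: (root_l _ _ hf he xf xe).
- exact: IHl.
- by case: (l_r _ _ he hf xe xf).
- by case: (root_r _ _ hf he xf xe).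
- by case: (l_r _ _ hf he xf xe).
- exact: IHr.
Qed.

(** A crossing between the root edge and an edge of a child either contradicts the order of the two
    subtrees or puts the child's unmatched point under that edge, although it is exposed. *)
Lemma matching_laminar t : ordered t -> laminar (matching t).
Proof.
elim: t => [y|l IHl r IHr] //= /[dup] lr.
rewrite ordered_node => /and3P[_ sl sr] e f.
rewrite !inE => /or3P[] he /or3P[] hf [h1 h2 h3].
- have [[e1 _] [f1 _]] := (root_edgeP he, root_edgeP hf).
  by move: f1 h1; rewrite e1 => -[->]; rewrite ltxx.
- have [_ e2] := root_edge_points he; have [_ _ f2] := matching_edge sl hf.
  by have := lt_trans h3 (ordered_lt lr f2 e2); rewrite ltxx.
- have [_ e2] := root_edgeP he; have := unmatched_exposed sr e2 hf.
  by case=> [/(lt_trans h3)|/(lt_trans h2)]; rewrite ltxx.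
- have [f1 _] := root_edgeP hf; have := unmatched_exposed sl f1 he.
  by case=> [/(lt_trans h2)|/(lt_trans h1)]; rewrite ltxx.
- exact: (IHl sl e f).
- have [_ _ e2] := matching_edge sl he; have [_ f1 _] := matching_edge sr hf.
  by have := lt_trans h2 (ordered_lt lr e2 f1); rewrite ltxx.
- have [f1 _] := root_edge_points hf; have [_ e1 _] := matching_edge sr he.
  by have := lt_trans h1 (ordered_lt lr f1 e1); rewrite ltxx.
- have [_ e1 _] := matching_edge sr he; have [_ f1 _] := matching_edge sl hf.
  by have := lt_trans h1 (ordered_lt lr f1 e1); rewrite ltxx.
- exact: (IHr sr e f).
Qed.

(** Edges from different children do not overlap. Hence, apart from the root edge, a pairwise
    overlapping family lies within one child, and each level contributes at most one edge. *)
Lemma overlap_card t (C : {fset edge R}) : ordered t -> C `<=` matching t ->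
  {in C &, forall e f, overlap e f} -> (#|` C| <= height t)%N.
Proof.
elim: t C => [y|l IHl r IHr] C /=.
  by rewrite fsubset0 => _ /eqP-> _; rewrite cardfs0.
move=> /[dup] lr; rewrite ordered_node => /and3P[_ sl sr] /fsubsetP CE ov.
pose C' := C `\` root_edge l r.
have CC' : (#|` C| <= 1 + #|` C'|)%N.
  rewrite -(cardfsID (root_edge l r) C) leq_add2r.
  apply: leq_trans (card_root_edge l r); apply: fsubset_leq_card.
  exact: fsubsetIr.
have ov' : {in C' &, forall e f, overlap e f}.
  by move=> e f; rewrite !inE => /andP[_ eC] /andP[_ fC]; exact: ov.
have C'E e : e \in C' -> (e \in matching l) || (e \in matching r).
  by rewrite !inE => /andP[/negPf er /CE]; rewrite !inE er.
suff : (C' `<=` matching l) || (C' `<=` matching r).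
  case/orP => [/(IHl _ sl)/(_ ov')|/(IHr _ sr)/(_ ov')] h;
    by apply: leq_trans CC' _; apply: leq_trans (leq_add (leqnn 1) h) _; lia.
apply/orP; case: (boolP (C' `<=` matching l)) => [|/fsubsetPn[e eC el]]; [by left|].
have er : e \in matching r by move: (C'E _ eC); rewrite (negPf el).
right; apply/fsubsetP => f fC; case/orP: (C'E _ fC) => // fl.
have [_ e1 _] := matching_edge sr er; have [_ _ f2] := matching_edge sl fl.
have /andP[] := ov' _ _ eC fC.
by rewrite ltNge (ltW (ordered_lt lr f2 e1)).
Qed.

Lemma depth_matching t : ordered t -> (depth (matching t) <= height t)%N.
Proof.
move=> st; apply/bigmax_leqP_seq => C; rewrite fpowersetE => CE ov.
by apply: overlap_card => // e f eC fC; move/allrelP: ov; apply.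
Qed.

Lemma matching_near_perfect t (S : {fset R}) : ordered t -> S =i points t ->
  near_perfect_matching S (matching t).
Proof.
move=> st St; split; first split.
- by move=> e /(matching_edge st)[-> e1 e2]; rewrite !St.
- by move=> e f x; exact: matching_disjoint.
have sub x : x \in [fset x in S | ~~ has (incident x) (matching t)] ->
    unmatched t = Some x.
  by rewrite !inE /= St => /andP[/matching_cover]; case: has => //= /eqP.
case: (fset_0Vmem [fset x in S | ~~ has (incident x) (matching t)]) => [->|].
  by rewrite cardfs0.
move=> [p /sub up]; rewrite -(cardfs1 p); apply: fsubset_leq_card.
by apply/fsubsetP => x /sub; rewrite up inE => -[->].
Qed.

(** * The data structure and its invariants *)

Definition tree_update ol (u : update R) : option tree :=
  match u with
  | Insert x => Some (if ol is Some t then insert x t else Leaf x)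
  | Delete x => obind (delete x) ol
  end.

(** The state [None] stands for the empty point set, since every [tree] has at least one leaf. *)
Definition tree_structure : data_structure R :=
  DataStructure None tree_update omatching.

Definition valid ol : bool := oapp (fun t => ordered t && avl t) true ol.

Definition tree_state us : option tree := foldl tree_update None us.

Lemma tree_state_rcons us u :
  tree_state (rcons us u) = tree_update (tree_state us) u.
Proof. exact: foldl_rcons. Qed.

Lemma tree_update_valid ol u : valid ol -> valid (tree_update ol u).
Proof.
case: u ol => x [t|] //= /andP[st at_].
  by rewrite ordered_insert//; have [->] := avl_insert x at_.
have := avl_delete x at_; have := points_delete x st.
case: delete => //= t' pt' [-> _ _]; rewrite andbT /ordered pt'.
exact: pairwise_filter.
Qed.

Lemma tree_state_valid us : valid (tree_state us).
Proof.
by elim/last_ind: us => // us u; rewrite tree_state_rcons; exact: tree_update_valid.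
Qed.

Lemma tree_state_points us : point_set us =i opoints (tree_state us).
Proof.
elim/last_ind: us => [x|us u IH x]; first by rewrite !inE.
rewrite tree_state_rcons /point_set foldl_rcons.
have := tree_state_valid us; move: IH; rewrite -/(point_set us).
case: u (tree_state us) => y [t|] /= IH v; rewrite !inE ?IH ?andbF ?orbF//=.
  by rewrite mem_insert.
by case/andP: v => st _; rewrite points_delete// mem_filter.
Qed.

Lemma card_points t (S : {fset R}) :
  ordered t -> S =i points t -> #|` S| = size (points t).
Proof.
move=> st St; apply/perm_size/uniq_perm => //.
by apply: (sorted_uniq lt_trans ltxx); exact: pairwise_sorted.
Qed.

(** The bound uses the height after the update, because the theorem measures the point set at that
    time. An insertion does not lower the tree, and a deletion lowers it by at most one, which the
    successor absorbs. *)
Lemma modified_update ol u t' : valid ol -> tree_update ol u = Some t' ->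
  (#|` modified_edges (omatching ol) (matching t')| <= 12 * (height t').+1)%N.
Proof.
case: u ol => x [t|] //= v [] ut'.
- have /andP[_ /(avl_insert x)[_ h _]] := v.
  by rewrite -ut'; apply: leq_trans (modified_insert x t) _; rewrite leq_mul2l.
- by rewrite -ut' modified_edgesxx cardfs0.
- have /andP[_ /(avl_delete x)] := v; rewrite ut' => -[_ _ h].
  have := modified_delete x t; rewrite ut' => /leq_trans; apply.
  by rewrite leq_mul2l.
Qed.

Lemma tree_state_nonempty us : (0 < #|` point_set us|)%N ->
  exists2 t, tree_state us = Some t &
    [/\ ordered t, avl t & #|` point_set us| = size (points t)].
Proof.
have := tree_state_valid us; have := tree_state_points us.
case: tree_state => [t|] /= pt; last first.
  by have -> : point_set us = fset0 by apply/fsetP => x; rewrite pt.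
move=> /andP[st at_] _; exists t => //; split=> //; exact: card_points.
Qed.

End LaminarTree.

(** * Logarithmic bounds and the theorem *)

Lemma height_ln (R : realType) (t : tree R) : avl t ->
  (height t)%:R * ln 2 <= 2 * ln (size (points t))%:R :> R.
Proof.
move=> /avl_size h.
have s0 : (0 < size (points t))%N.
  by move: h; case: size => //; rewrite exp0n// leqn0 expn_eq0.
have : ln ((2 ^ height t)%:R : R) <= ln ((size (points t) ^ 2)%:R).
  by rewrite ler_ln ?ler_nat// posrE ltr0n expn_gt0 ?s0.
by rewrite !natrX !lnXn ?ltr0n// !mulr_natl.
Qed.

Theorem theorem7p2 (R : realType) :
  exists (D : data_structure R) (c : R),
    (forall us : seq (update R),
       [/\ near_perfect_matching (point_set us) (maintained D us),
           laminar (maintained D us)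
         & (2 <= #|` point_set us|)%N ->
           (depth (maintained D us))%:R <= c * ln (#|` point_set us|%:R)]) /\
    (forall (us : seq (update R)) (u : update R),
       (2 <= #|` point_set (rcons us u)|)%N ->
       #|` modified_edges (maintained D us) (maintained D (rcons us u))|%:R
         <= c * (ln (#|` point_set (rcons us u)|%:R)) ^+ 2).
Proof.
have u0 : 0 < ln 2 :> R by rewrite ln_gt0 ?ltr1n.
set u := ln 2 in u0 *.
have ln2_le n : (2 <= n)%N -> u <= ln n%:R.
  by move=> n2; rewrite ler_ln ?posrE ?ltr0n ?ler_nat//; lia.
(* The summand [2 / u] serves the depth bound and [36 / u ^+ 2] the bound on modified edges; one
   constant has to serve both. *)
exists (@tree_structure R), (2 / u + 36 / u ^+ 2); split=> [us|us up].
  rewrite /maintained -/(tree_state us) /=.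
  have := tree_state_valid us; have := tree_state_points us.
  case E : (tree_state us) => [t|] /= pt; last first.
    have -> : point_set us = fset0 by apply/fsetP => x; rewrite pt.
    move=> _; split=> //; split; first by split.
    rewrite (_ : [fset x in _ | _] = fset0) ?cardfs0//.
    by apply/fsetP => x; rewrite !inE.
  move=> /andP[st at_]; split;
    [exact: matching_near_perfect|exact: matching_laminar|].
  rewrite (card_points st pt) => n2; set L := ln _.
  have L0 : 0 <= L by apply: le_trans (ltW u0) (ln2_le _ n2).
  apply: (@le_trans _ _ (height t)%:R); first by rewrite ler_nat depth_matching.
  have := height_ln at_; rewrite -/u -/L -ler_pdivlMr// => /le_trans; apply.
  have -> : (2 / u + 36 / u ^+ 2) * L = 2 * L / u + 36 / u ^+ 2 * L.
    by field; rewrite gt_eqF.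
  rewrite lerDl mulr_ge0// divr_ge0// exprn_ge0//.
  exact: ltW.
move=> n2; have [t E [st at_ n]] := tree_state_nonempty (ltnW n2).
have := E; rewrite tree_state_rcons => /(modified_update (tree_state_valid us)).
rewrite /maintained -/(tree_state us) -/(tree_state (rcons us up)) E /=.
rewrite n in n2 *; move: (height_ln at_) (ln2_le _ n2); rewrite -/u.
set L := ln _ => hL uL m.
apply: (@le_trans _ _ (12 * (height t).+1)%:R); first by rewrite ler_nat.
have -> : (2 / u + 36 / u ^+ 2) * L ^+ 2 = 2 * L ^+ 2 / u + 36 * (L / u) ^+ 2.
  by field; rewrite gt_eqF.
(* With [a = L / u], the binary logarithm of the number of points, the height is at most [2 * a]. As
   [a] is at least 1, [12 * (2 * a + 1)] is at most [36 * a], hence at most [36 * a ^+ 2]. *)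
have a1 : 1 <= L / u by rewrite ler_pdivlMr// mul1r.
have hs : (height t)%:R <= 2 * (L / u) by rewrite mulrA ler_pdivlMr.
have q0 : 0 <= 2 * L ^+ 2 / u.
  by apply: divr_ge0 (ltW u0); apply: mulr_ge0; rewrite ?sqr_ge0.
by rewrite natrM -natr1; move: (L / u) a1 hs (_ / u) q0 => a a1 hs q q0; nra.
Qed.
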